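(* Let $\mathcal{B}=(a_1,a_2)\subset\mathbb{R}$, $\tau>0$, and let $\rho_0>0$ and $c>0$ be constants. Let $u^0=u(x,t)$ be a smooth displacement field on $\mathcal{B}\times[0,\tau]$ which is a stationary point of $\int_0^\tau\int_{\mathcal{B}}L^0\,dx\,dt$, where $$L^0=\frac{\rho_0}{2}\left(\frac{\partial u^0}{\partial t}\right)^2-\frac{c}{2}\left(\frac{\partial u^0}{\partial x}\right)^2$$ is the classic Lagrangian. For $i=0,1,2,\dots$ define recursively $$u^{i+1}=\frac{\rho_0}{2}\left(\frac{\partial u^i}{\partial t}\right)^2+\frac{c}{2}\left(\frac{\partial u^i}{\partial x}\right)^2,\qquad L^i=\frac{\rho_0}{2}\left(\frac{\partial u^i}{\partial t}\right)^2-\frac{c}{2}\left(\frac{\partial u^i}{\partial x}\right)^2 .$$ Then for every $i=0,1,2,\dots$ the least action principle $$\delta^i\int_0^\tau\int_{\mathcal{B}}L^i\,dx\,dt=0$$ holds, where $\delta^i$ denotes the variation taken with respect to $u^i$; i.e. $u^i$ is a stationary point of the functional $w\mapsto\int_0^\tau\int_{\mathcal{B}}\left[\frac{\rho_0}{2}(\partial_t w)^2-\frac{c}{2}(\partial_x w)^2\right]dx\,dt$.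
   Context: A smooth field $w$ is a stationary point of a functional $\mathcal{A}(w)=\int_0^\tau\int_{\mathcal{B}}(\cdots)\,dx\,dt$ if $\frac{d}{d\epsilon}\big|_{\epsilon=0}\mathcal{A}(w+\epsilon\varphi)=0$ for every smooth $\varphi$ compactly supported in $\mathcal{B}\times(0,\tau)$. In the variation $\delta^i$ the field $u^i$ is treated as an independent field (its dependence on $u^{i-1}$ is ignored). *)

(* Defs.v *)
From Stdlib Require Export Reals.
From Coquelicot Require Export Coquelicot.
Open Scope R_scope.

(* A field is a total function [w x t] of position and time. *)
Definition dx (w : R -> R -> R) (x t : R) : R := Derive (fun y => w y t) x.
Definition dt (w : R -> R -> R) (x t : R) : R := Derive (fun s => w x s) t.

Definition lagrangian (rho0 c : R) (w : R -> R -> R) (x t : R) : R :=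
  rho0 / 2 * (dt w x t) ^ 2 - c / 2 * (dx w x t) ^ 2.

Definition energy (rho0 c : R) (w : R -> R -> R) (x t : R) : R :=
  rho0 / 2 * (dt w x t) ^ 2 + c / 2 * (dx w x t) ^ 2.

Fixpoint field_seq (rho0 c : R) (u : R -> R -> R) (i : nat) : R -> R -> R :=
  match i with
  | O => u
  | S j => energy rho0 c (field_seq rho0 c u j)
  end.

(* C^infinity on a neighbourhood of every point of [D]: for a set [D] that is
   not open, this is the existence of a smooth extension to an open
   neighbourhood of [D], the extension being [w] itself. *)
Definition smooth_on (D : R -> R -> Prop) (w : R -> R -> R) : Prop :=
  forall x t, D x t ->
    locally_2d (fun y s => forall n : nat, ex_diff_n w n y s) x t.

(* [phi] is extended by zero to the whole plane; a compact subset of the open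
   rectangle is one that lies in some closed subrectangle. *)
Definition test_field (a1 a2 tau : R) (phi : R -> R -> R) : Prop :=
  smooth_on (fun _ _ => True) phi /\
  exists b1 b2 s1 s2 : R,
    (a1 < b1 /\ b1 <= b2 /\ b2 < a2) /\ (0 < s1 /\ s1 <= s2 /\ s2 < tau) /\
    forall x t, ~ (b1 <= x <= b2 /\ s1 <= t <= s2) -> phi x t = 0.

(* Integrals over the open intervals, i.e. limits of Riemann integrals over
   compact subintervals: a field that is smooth on (a1,a2) x [0,tau] may have
   derivatives that are unbounded as x tends to a1 or a2.  When the integrand is
   continuous on [a1,a2] x [0,tau] this is the usual iterated integral. *)
Definition action (a1 a2 tau rho0 c : R) (w : R -> R -> R) : R :=
  RInt_gen
    (fun t => RInt_gen (fun x => lagrangian rho0 c w x t)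
                (at_right a1) (at_left a2))
    (at_right 0) (at_left tau).

(* The integrals in [action] converge.  [RInt_gen] returns an unspecified real
   otherwise.  This property is stable under adding a test field to a field
   that is smooth on the rectangle, and it is automatic for fields that are
   smooth up to the boundary of the closed rectangle. *)
Definition action_defined (a1 a2 tau rho0 c : R) (w : R -> R -> R) : Prop :=
  (forall t, 0 < t < tau ->
     ex_RInt_gen (fun x => lagrangian rho0 c w x t) (at_right a1) (at_left a2)) /\
  ex_RInt_gen
    (fun t => RInt_gen (fun x => lagrangian rho0 c w x t)
                (at_right a1) (at_left a2))
    (at_right 0) (at_left tau).

Definition stationary (a1 a2 tau rho0 c : R) (w : R -> R -> R) : Prop :=
  forall phi : R -> R -> R, test_field a1 a2 tau phi ->
    is_derive
      (fun eps : R =>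
         action a1 a2 tau rho0 c (fun x t => w x t + eps * phi x t))
      0 0.

(* Main.v *)
Require Import Defs.
From Stdlib Require Import Lra Lia.

(** Adding a test field [phi] changes the Lagrangian only on a compact rectangle,
    so the action of [w + eps phi] is a quadratic polynomial in [eps] whose linear
    coefficient, after integration by parts, is minus the double integral of
    [(rho0 w_tt - c w_xx) phi].  By the fundamental lemma of the calculus of
    variations, stationarity is thus equivalent to the wave equation
    [rho0 w_tt = c w_xx] in the open rectangle.  The energy density [E] of a
    solution is again a solution: [E_t = c (w_t w_x)_x] and
    [E_x = rho0 (w_t w_x)_t], so [rho0 E_tt] and [c E_xx] are the same mixed
    derivative of [w_t w_x]. *)

(** * Calculus of [C^n] functions on open sets of the plane *)

Definition open_2d (D : R -> R -> Prop) : Prop :=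
  forall x t, D x t -> locally_2d D x t.

(** [ex_diff_n] is a condition at a single point: the iterated partial derivatives up to order [n]
    exist and are continuous there. Imposed at every point of an open [D], it is membership in the
    class C^n. *)
Definition Cn (D : R -> R -> Prop) (n : nat) (f : R -> R -> R) : Prop :=
  forall x t, D x t -> ex_diff_n f n x t.

Lemma open_2d_locally (D P : R -> R -> Prop) :
  open_2d D -> (forall x t, D x t -> P x t) ->
  forall x t, D x t -> locally_2d P x t.
Proof.
  intros HD HP x t Hxt.
  destruct (HD x t Hxt) as [d Hd]; exists d; auto.
Qed.

Lemma Cn_le (D : R -> R -> Prop) (m n : nat) (f : R -> R -> R) :
  (m <= n)%nat -> Cn D n f -> Cn D m f.
Proof. intros Hmn Hf x t Hxt; apply ex_diff_n_m with n; auto. Qed.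

Lemma Cn_ext (D : R -> R -> Prop) (n : nat) (f g : R -> R -> R) :
  open_2d D -> (forall x t, D x t -> f x t = g x t) -> Cn D n f -> Cn D n g.
Proof.
  intros HD Hfg Hf x t Hxt; apply ex_diff_n_ext_loc with f; auto.
  revert x t Hxt; apply open_2d_locally; auto.
Qed.

Lemma Cn_continuity_2d (D : R -> R -> Prop) (n : nat) (f : R -> R -> R) x t :
  Cn D n f -> D x t -> continuity_2d_pt f x t.
Proof. intros Hf Hxt; specialize (Hf x t Hxt); destruct n; apply Hf. Qed.

Lemma Cn_ex_derive_x (D : R -> R -> Prop) (n : nat) (f : R -> R -> R) x t :
  Cn D (S n) f -> D x t -> ex_derive (fun y => f y t) x.
Proof. intros Hf Hxt; apply (Hf x t Hxt). Qed.

Lemma Cn_ex_derive_t (D : R -> R -> Prop) (n : nat) (f : R -> R -> R) x t :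
  Cn D (S n) f -> D x t -> ex_derive (fun s => f x s) t.
Proof. intros Hf Hxt; apply (Hf x t Hxt). Qed.

Lemma Cn_dx (D : R -> R -> Prop) (n : nat) (f : R -> R -> R) :
  Cn D (S n) f -> Cn D n (dx f).
Proof. intros Hf x t Hxt; apply (Hf x t Hxt). Qed.

Lemma Cn_dt (D : R -> R -> Prop) (n : nat) (f : R -> R -> R) :
  Cn D (S n) f -> Cn D n (dt f).
Proof. intros Hf x t Hxt; apply (Hf x t Hxt). Qed.

(** Introduction rule behind the closure properties below, which go by induction on [n]. It accepts
    partial derivatives in closed form; as [D] is open, they agree with those computed by [Derive]
    near each point, so they have the same regularity. *)
Lemma Cn_S (D : R -> R -> Prop) (n : nat) (f fx ft : R -> R -> R) :
  open_2d D ->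
  (forall x t, D x t -> continuity_2d_pt f x t) ->
  (forall x t, D x t -> is_derive (fun y => f y t) x (fx x t)) ->
  (forall x t, D x t -> is_derive (fun s => f x s) t (ft x t)) ->
  Cn D n fx -> Cn D n ft -> Cn D (S n) f.
Proof.
  intros HD Hc Hfx Hft Hnx Hnt x t Hxt.
  split; [now apply Hc |].
  split; [exists (fx x t); now apply Hfx |].
  split; [exists (ft x t); now apply Hft |].
  split; revert x t Hxt.
  - apply (Cn_ext D n fx); auto.
    intros x t Hxt; symmetry; apply is_derive_unique, Hfx, Hxt.
  - apply (Cn_ext D n ft); auto.
    intros x t Hxt; symmetry; apply is_derive_unique, Hft, Hxt.
Qed.

Lemma Cn_const (D : R -> R -> Prop) (n : nat) (k : R) :
  open_2d D -> Cn D n (fun _ _ => k).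
Proof.
  intros HD; revert k; induction n as [|n IH]; intros k.
  - intros x t _; split; auto; apply continuity_2d_pt_const.
  - apply Cn_S with (fun _ _ => 0) (fun _ _ => 0); auto; intros x t _.
    + apply continuity_2d_pt_const.
    + apply (is_derive_const k).
    + apply (is_derive_const k).
Qed.

Lemma Cn_plus (D : R -> R -> Prop) (n : nat) (f g : R -> R -> R) :
  open_2d D -> Cn D n f -> Cn D n g -> Cn D n (fun x t => f x t + g x t).
Proof.
  intros HD; revert f g; induction n as [|n IH]; intros f g Hf Hg.
  - intros x t Hxt; split; auto.
    apply continuity_2d_pt_plus; [apply (Hf x t Hxt) | apply (Hg x t Hxt)].
  - apply Cn_S with (fun x t => dx f x t + dx g x t)
                    (fun x t => dt f x t + dt g x t); auto.
    + intros x t Hxt.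
      apply continuity_2d_pt_plus; [apply (Hf x t Hxt) | apply (Hg x t Hxt)].
    + intros x t Hxt; apply @is_derive_plus; apply Derive_correct;
        [apply (Hf x t Hxt) | apply (Hg x t Hxt)].
    + intros x t Hxt; apply @is_derive_plus; apply Derive_correct;
        [apply (Hf x t Hxt) | apply (Hg x t Hxt)].
    + apply IH; now apply Cn_dx.
    + apply IH; now apply Cn_dt.
Qed.

Lemma is_derive_Rmult (f g : R -> R) (x : R) :
  ex_derive f x -> ex_derive g x ->
  is_derive (fun y => f y * g y) x (Derive f x * g x + f x * Derive g x).
Proof.
  intros Hf Hg; auto_derive; [tauto |].
  change (Derive (fun y => f y) x) with (Derive f x).
  change (Derive (fun y => g y) x) with (Derive g x).
  ring.
Qed.

Lemma Cn_mult (D : R -> R -> Prop) (n : nat) (f g : R -> R -> R) :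
  open_2d D -> Cn D n f -> Cn D n g -> Cn D n (fun x t => f x t * g x t).
Proof.
  intros HD; revert f g; induction n as [|n IH]; intros f g Hf Hg.
  - intros x t Hxt; split; auto.
    apply continuity_2d_pt_mult; [apply (Hf x t Hxt) | apply (Hg x t Hxt)].
  - assert (Hf' : Cn D n f) by (apply Cn_le with (S n); auto).
    assert (Hg' : Cn D n g) by (apply Cn_le with (S n); auto).
    apply Cn_S with (fun x t => dx f x t * g x t + f x t * dx g x t)
                    (fun x t => dt f x t * g x t + f x t * dt g x t); auto.
    + intros x t Hxt.
      apply continuity_2d_pt_mult; [apply (Hf x t Hxt) | apply (Hg x t Hxt)].
    + intros x t Hxt; apply (is_derive_Rmult (fun y => f y t) (fun y => g y t));
        [apply (Hf x t Hxt) | apply (Hg x t Hxt)].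
    + intros x t Hxt; apply (is_derive_Rmult (fun s => f x s) (fun s => g x s));
        [apply (Hf x t Hxt) | apply (Hg x t Hxt)].
    + apply Cn_plus; auto; apply IH; auto; now apply Cn_dx.
    + apply Cn_plus; auto; apply IH; auto; now apply Cn_dt.
Qed.

Lemma Cn_lin (D : R -> R -> Prop) (n : nat) (p q : R) (f g : R -> R -> R) :
  open_2d D -> Cn D n f -> Cn D n g ->
  Cn D n (fun x t => p * f x t + q * g x t).
Proof.
  intros HD Hf Hg; apply Cn_plus; auto; apply Cn_mult; auto; now apply Cn_const.
Qed.

(** * The bump function *)

(* [psi 0] is the standard smooth function [exp (-1/x)]; the family [psi k] is
   closed under differentiation up to linear combinations. *)
Definition psi (k : nat) (x : R) : R :=
  if Rlt_dec 0 x then exp (- / x) * (/ x) ^ k else 0.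

Lemma psi_pos (k : nat) (x : R) : 0 < x -> 0 < psi k x.
Proof.
  intros Hx; unfold psi; destruct (Rlt_dec 0 x) as [_ | n]; [|lra].
  apply Rmult_lt_0_compat; [apply exp_pos |].
  now apply pow_lt, Rinv_0_lt_compat.
Qed.

Lemma psi_0 (k : nat) (x : R) : x <= 0 -> psi k x = 0.
Proof. intros Hx; unfold psi; destruct (Rlt_dec 0 x); [lra | auto]. Qed.

Lemma psi_ge_0 (k : nat) (x : R) : 0 <= psi k x.
Proof.
  destruct (Rlt_dec 0 x) as [Hx|Hx].
  - now apply Rlt_le, psi_pos.
  - rewrite psi_0; lra.
Qed.

Lemma exp_INR_mult (n : nat) (y : R) : exp (INR n * y) = exp y ^ n.
Proof.
  induction n as [|n IH]; [simpl; rewrite Rmult_0_l; apply exp_0 |].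
  rewrite S_INR, Rmult_plus_distr_r, Rmult_1_l, exp_plus, IH; simpl; ring.
Qed.

(** Raise the inequality z <= exp z, at z = y / (m+1), to the power m+1. *)
Lemma pow_exp_bound (m : nat) (y : R) :
  0 < y -> y ^ S m * exp (- y) <= INR (S m) ^ S m.
Proof.
  intros Hy.
  assert (Hm : 0 < INR (S m)) by (apply lt_0_INR; lia).
  assert (Hexp : exp y = exp (y / INR (S m)) ^ S m).
  { rewrite <- exp_INR_mult; f_equal; field; lra. }
  assert (Hle : (y / INR (S m)) ^ S m <= exp y).
  { rewrite Hexp; apply pow_incr.
    assert (0 < y / INR (S m)) by (apply Rdiv_lt_0_compat; auto).
    assert (1 + y / INR (S m) < exp (y / INR (S m))) by (apply exp_ineq1; lra).
    lra. }
  rewrite exp_Ropp.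
  apply Rmult_le_reg_r with (exp y); [apply exp_pos |].
  rewrite Rmult_assoc, Rinv_l, Rmult_1_r by (apply Rgt_not_eq, exp_pos).
  replace y with (INR (S m) * (y / INR (S m))) at 1 by (field; lra).
  rewrite Rpow_mult_distr.
  apply Rmult_le_compat_l; auto.
  now apply Rlt_le, pow_lt.
Qed.

(** Away from the origin this is a direct computation on each side. At the origin the exponential
    beats every power of 1/x, so the difference quotient tends to zero. *)
Lemma is_derive_psi (k : nat) (x : R) :
  is_derive (psi k) x (psi (S (S k)) x - INR k * psi (S k) x).
Proof.
  destruct (Rtotal_order x 0) as [Hx | [-> | Hx]].
  - rewrite !psi_0 by lra.
    replace (0 - INR k * 0) with 0 by ring.
    apply is_derive_ext_loc with (fun _ => 0); [| apply (is_derive_const 0)].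
    apply (locally_interval _ x m_infty 0); simpl; auto.
    intros y _ Hy; rewrite psi_0; auto; lra.
  - rewrite !psi_0 by lra.
    replace (0 - INR k * 0) with 0 by ring.
    apply is_derive_Reals; intros e He.
    (* For h > 0, [psi k h / h] equals h times y^(k+2) exp(-y) with y = 1/h. By [pow_exp_bound] it
       is at most [h * M], whence the radius [e / M]. *)
    set (M := INR (S (S k)) ^ S (S k)).
    assert (HM : 0 < M) by (apply pow_lt, lt_0_INR; lia).
    assert (HeM : 0 < e / M) by (apply Rdiv_lt_0_compat; auto).
    exists (mkposreal _ HeM); intros h Hh0 Hh; simpl in Hh.
    rewrite Rplus_0_l, (psi_0 k 0), !Rminus_0_r by lra.
    destruct (Rlt_dec 0 h) as [Hh'|Hh'].
    + assert (Hb : psi k h / h <= h * M).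
      { generalize (pow_exp_bound (S k) (/ h) (Rinv_0_lt_compat _ Hh')).
        fold M; intros Hb; apply Rmult_le_compat_l with (r := h) in Hb; [|lra].
        replace (psi k h / h) with (h * ((/ h) ^ S (S k) * exp (- / h))); auto.
        unfold psi; destruct (Rlt_dec 0 h); [|lra].
        simpl; field; lra. }
      assert (0 <= psi k h / h).
      { apply Rmult_le_pos; [apply psi_ge_0 |].
        now apply Rlt_le, Rinv_0_lt_compat. }
      rewrite Rabs_pos_eq by auto.
      apply Rle_lt_trans with (h * M); auto.
      rewrite Rabs_pos_eq in Hh by lra.
      apply Rmult_lt_compat_r with (r := M) in Hh; auto.
      replace (e / M * M) with e in Hh by (field; lra); auto.
    + rewrite psi_0 by lra.
      unfold Rdiv; rewrite Rmult_0_l, Rabs_R0; auto.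
  - apply is_derive_ext_loc with (fun y => exp (- / y) * (/ y) ^ k).
    + apply (locally_interval _ x 0 p_infty); simpl; auto.
      intros y Hy _; unfold psi; destruct (Rlt_dec 0 y); [auto | lra].
    + unfold psi; destruct (Rlt_dec 0 x); [|lra].
      auto_derive; [split; [lra | split; [lra | auto]] |].
      (* The derivative of the power has exponent [pred k], so the exponent zero is treated
         apart. *)
      destruct k as [|k]; [simpl; field; lra |].
      rewrite Nat.pred_succ; simpl pow; field; lra.
Qed.

Lemma continuity_psi_affine (k : nat) (p q r x t : R) :
  continuity_2d_pt (fun x t => psi k (p * x + q * t + r)) x t.
Proof.
  apply (continuity_1d_2d_pt_comp (psi k) (fun x t => p * x + q * t + r)).
  - apply derivable_continuous_pt, ex_derive_Reals_0.
    eexists; apply is_derive_psi.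
  - apply continuity_2d_pt_plus; [|apply continuity_2d_pt_const].
    apply continuity_2d_pt_plus; apply continuity_2d_pt_mult;
      auto using continuity_2d_pt_const, continuity_2d_pt_id1, continuity_2d_pt_id2.
Qed.

Lemma Cn_psi_affine (D : R -> R -> Prop) (n k : nat) (p q r : R) :
  open_2d D -> Cn D n (fun x t => psi k (p * x + q * t + r)).
Proof.
  intros HD; revert k; induction n as [|n IH]; intros k.
  - intros x t _; split; auto; apply continuity_psi_affine.
  (* By the chain rule both partial derivatives have this form, with [m] equal to [p] in the
     direction of x and to [q] in that of t. The induction hypothesis covers them because it holds
     for all [k]. *)
  - assert (H : forall m, Cn D n (fun x t =>
      m * psi (S (S k)) (p * x + q * t + r)
      + (- m * INR k) * psi (S k) (p * x + q * t + r))).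
    { intros m; apply Cn_lin; auto. }
    apply Cn_S with (2 := fun x t _ => continuity_psi_affine k p q r x t)
                    (5 := H p) (6 := H q); auto; intros x t _.
    + evar_last.
      apply (is_derive_comp (psi k) (fun y => p * y + q * t + r));
        [apply is_derive_psi | auto_derive; auto; reflexivity].
      unfold scal; simpl; unfold mult; simpl; ring.
    + evar_last.
      apply (is_derive_comp (psi k) (fun s => p * x + q * s + r));
        [apply is_derive_psi | auto_derive; auto; reflexivity].
      unfold scal; simpl; unfold mult; simpl; ring.
Qed.

(** Each factor vanishes beyond one side of the rectangle. The arguments are spelled out as
    [p * x + q * t + r], with trivial coefficients too, to match [Cn_psi_affine]. *)
Definition bump (b1 b2 s1 s2 x t : R) : R :=
  (psi 0 (1 * x + 0 * t + - b1) * psi 0 (-1 * x + 0 * t + b2)) *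
  (psi 0 (0 * x + 1 * t + - s1) * psi 0 (0 * x + -1 * t + s2)).

Lemma Cn_bump (D : R -> R -> Prop) (n : nat) (b1 b2 s1 s2 : R) :
  open_2d D -> Cn D n (bump b1 b2 s1 s2).
Proof.
  intros HD; apply Cn_mult; auto; apply Cn_mult; auto; now apply Cn_psi_affine.
Qed.

Lemma bump_pos (b1 b2 s1 s2 x t : R) :
  b1 < x < b2 -> s1 < t < s2 -> 0 < bump b1 b2 s1 s2 x t.
Proof.
  intros Hx Ht; unfold bump.
  apply Rmult_lt_0_compat; apply Rmult_lt_0_compat; apply psi_pos; lra.
Qed.

Lemma bump_0 (b1 b2 s1 s2 x t : R) :
  ~ (b1 < x < b2 /\ s1 < t < s2) -> bump b1 b2 s1 s2 x t = 0.
Proof.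
  intros H; unfold bump.
  destruct (Rlt_dec b1 x); [|rewrite (psi_0 0 (1 * x + 0 * t + - b1)) by lra; ring].
  destruct (Rlt_dec x b2); [|rewrite (psi_0 0 (-1 * x + 0 * t + b2)) by lra; ring].
  destruct (Rlt_dec s1 t); [|rewrite (psi_0 0 (0 * x + 1 * t + - s1)) by lra; ring].
  destruct (Rlt_dec t s2); [|rewrite (psi_0 0 (0 * x + -1 * t + s2)) by lra; ring].
  tauto.
Qed.

(** * Integrals over compact rectangles *)

Definition box (a1 a2 tau x t : R) : Prop := a1 < x < a2 /\ 0 < t < tau.

(** Serves for space and for time. The strict gaps keep the compact rectangle within [box], where
    the fields are known to be regular. *)
Definition inside (a1 a2 b1 b2 : R) : Prop := a1 < b1 /\ b1 < b2 /\ b2 < a2.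

Lemma locally_interval_R (a b x : R) (P : R -> Prop) :
  a < x < b -> (forall y, a < y < b -> P y) -> locally x P.
Proof.
  intros Hx HP; apply (locally_interval P x a b); simpl; try tauto.
  intros y Hy1 Hy2; auto.
Qed.

Lemma open_box (a1 a2 tau : R) : open_2d (box a1 a2 tau).
Proof.
  intros x t [Hx Ht].
  assert (Hd : 0 < Rmin (Rmin (x - a1) (a2 - x)) (Rmin t (tau - t))).
  { repeat apply Rmin_glb_lt; lra. }
  exists (mkposreal _ Hd); simpl; intros y s Hy Hs.
  apply Rmin_Rgt_l in Hy; destruct Hy as [Hy _].
  apply Rmin_Rgt_l in Hy; destruct Hy as [Hy1 Hy2].
  apply Rmin_Rgt_l in Hs; destruct Hs as [_ Hs].
  apply Rmin_Rgt_l in Hs; destruct Hs as [Hs1 Hs2].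
  apply Rgt_lt, Rabs_def2 in Hy1; apply Rgt_lt, Rabs_def2 in Hy2.
  apply Rgt_lt, Rabs_def2 in Hs1; apply Rgt_lt, Rabs_def2 in Hs2.
  unfold box; lra.
Qed.

#[local] Hint Resolve open_box : core.

Lemma continuity_2d_pt_x (f : R -> R -> R) (x t : R) :
  continuity_2d_pt f x t -> continuous (fun y => f y t) x.
Proof.
  intros Hf; apply continuity_pt_filterlim; intros e He.
  destruct (Hf (mkposreal e He)) as [d Hd]; exists d; split; [apply cond_pos |].
  intros y [_ Hy]; apply Hd; auto.
  rewrite Rminus_diag, Rabs_R0; apply cond_pos.
Qed.

Lemma Cn_continuous_x (a1 a2 tau : R) (n : nat) (f : R -> R -> R) (x t : R) :
  Cn (box a1 a2 tau) n f -> a1 < x < a2 -> 0 < t < tau ->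
  continuous (fun y => f y t) x.
Proof.
  intros Hf Hx Ht; apply continuity_2d_pt_x.
  now apply (Cn_continuity_2d (box a1 a2 tau) n); [|split].
Qed.

Lemma Cn_ex_RInt_x (a1 a2 tau b1 b2 : R) (n : nat) (f : R -> R -> R) (t : R) :
  inside a1 a2 b1 b2 -> Cn (box a1 a2 tau) n f -> 0 < t < tau ->
  ex_RInt (fun x => f x t) b1 b2.
Proof.
  intros (H1 & H2 & H3) Hf Ht; apply (ex_RInt_continuous (fun x => f x t)).
  intros x Hx; rewrite Rmin_left, Rmax_right in Hx by lra.
  apply (Cn_continuous_x a1 a2 tau n); auto; lra.
Qed.

Lemma is_derive_RInt_x (a1 a2 tau b1 b2 : R) (n : nat) (f : R -> R -> R) (t : R) :
  inside a1 a2 b1 b2 -> Cn (box a1 a2 tau) (S n) f -> 0 < t < tau ->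
  is_derive (fun s => RInt (fun x => f x s) b1 b2) t
    (RInt (fun x => dt f x t) b1 b2).
Proof.
  intros Hb Hf Ht.
  assert (Hx : forall x, Rmin b1 b2 <= x <= Rmax b1 b2 -> a1 < x < a2).
  { destruct Hb as (H1 & H2 & H3); intros x.
    rewrite Rmin_left, Rmax_right by lra; lra. }
  apply (is_derive_RInt_param (fun s x => f x s)).
  - apply (locally_interval_R 0 tau); auto; intros s Hs x Hx'.
    apply (Cn_ex_derive_t (box a1 a2 tau) n); auto; split; auto.
  - intros x Hx'.
    assert (Hc : continuity_2d_pt (dt f) x t).
    { apply (Cn_continuity_2d (box a1 a2 tau) n); [now apply Cn_dt | split; auto]. }
    (* The rule for parametric integrals takes the parameter, here time, as first argument; the
       continuity is the same with the variables exchanged. *)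
    intros e; destruct (Hc e) as [d Hd]; exists d; intros u v Hu Hv.
    now apply (Hd v u).
  - apply (locally_interval_R 0 tau); auto; intros s Hs.
    now apply (Cn_ex_RInt_x a1 a2 tau b1 b2 (S n)).
Qed.

(** Continuity in time is drawn from differentiation under the integral sign, which explains the
    order [S n] here and in the results on [RInt2]. *)
Lemma continuous_RInt_x (a1 a2 tau b1 b2 : R) (n : nat) (f : R -> R -> R) (t : R) :
  inside a1 a2 b1 b2 -> Cn (box a1 a2 tau) (S n) f -> 0 < t < tau ->
  continuous (fun s => RInt (fun x => f x s) b1 b2) t.
Proof.
  intros Hb Hf Ht; apply (ex_derive_continuous (fun s => RInt (fun x => f x s) b1 b2)).
  eexists; now apply (is_derive_RInt_x a1 a2 tau b1 b2 n).
Qed.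

Definition RInt2 (b1 b2 s1 s2 : R) (f : R -> R -> R) : R :=
  RInt (fun t => RInt (fun x => f x t) b1 b2) s1 s2.

Lemma ex_RInt2 (a1 a2 tau b1 b2 s1 s2 : R) (n : nat) (f : R -> R -> R) :
  inside a1 a2 b1 b2 -> inside 0 tau s1 s2 -> Cn (box a1 a2 tau) (S n) f ->
  ex_RInt (fun t => RInt (fun x => f x t) b1 b2) s1 s2.
Proof.
  intros Hb (H1 & H2 & H3) Hf.
  apply (ex_RInt_continuous (fun t => RInt (fun x => f x t) b1 b2)); intros t Ht.
  rewrite Rmin_left, Rmax_right in Ht by lra.
  apply (continuous_RInt_x a1 a2 tau b1 b2 n); auto; lra.
Qed.

Lemma RInt2_ext (b1 b2 s1 s2 : R) (f g : R -> R -> R) :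
  b1 < b2 -> s1 < s2 ->
  (forall x t, b1 < x < b2 -> s1 < t < s2 -> f x t = g x t) ->
  RInt2 b1 b2 s1 s2 f = RInt2 b1 b2 s1 s2 g.
Proof.
  intros Hb Hs Hfg; apply RInt_ext; intros t Ht.
  rewrite Rmin_left, Rmax_right in Ht by lra.
  apply RInt_ext; intros x Hx.
  rewrite Rmin_left, Rmax_right in Hx by lra; auto.
Qed.

Lemma RInt_lin (a b p q : R) (f g : R -> R) :
  ex_RInt f a b -> ex_RInt g a b ->
  RInt (fun x => p * f x + q * g x) a b = p * RInt f a b + q * RInt g a b.
Proof.
  intros Hf Hg; apply is_RInt_unique.
  apply (is_RInt_plus (fun x => p * f x) (fun x => q * g x)).
  - now apply (is_RInt_scal f a b p), (RInt_correct f).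
  - now apply (is_RInt_scal g a b q), (RInt_correct g).
Qed.

Lemma RInt2_lin (a1 a2 tau b1 b2 s1 s2 p q : R) (n : nat) (f g : R -> R -> R) :
  inside a1 a2 b1 b2 -> inside 0 tau s1 s2 ->
  Cn (box a1 a2 tau) (S n) f -> Cn (box a1 a2 tau) (S n) g ->
  RInt2 b1 b2 s1 s2 (fun x t => p * f x t + q * g x t)
  = p * RInt2 b1 b2 s1 s2 f + q * RInt2 b1 b2 s1 s2 g.
Proof.
  intros Hb Hs Hf Hg; unfold RInt2.
  rewrite <- RInt_lin; try now apply (ex_RInt2 a1 a2 tau b1 b2 s1 s2 n).
  apply RInt_ext; intros t Ht.
  destruct Hs as (H1 & H2 & H3); rewrite Rmin_left, Rmax_right in Ht by lra.
  apply RInt_lin; apply (Cn_ex_RInt_x a1 a2 tau b1 b2 (S n)); auto; lra.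
Qed.

Lemma RInt2_dx (a1 a2 tau b1 b2 s1 s2 : R) (n : nat) (f : R -> R -> R) :
  inside a1 a2 b1 b2 -> inside 0 tau s1 s2 -> Cn (box a1 a2 tau) (S n) f ->
  (forall t, f b1 t = 0) -> (forall t, f b2 t = 0) ->
  RInt2 b1 b2 s1 s2 (dx f) = 0.
Proof.
  intros (H1 & H2 & H3) (H4 & H5 & H6) Hf Hf1 Hf2; unfold RInt2.
  rewrite (RInt_ext _ (fun _ => 0)).
  - rewrite RInt_const; apply (Rmult_0_r (s2 - s1)).
  - intros t Ht; rewrite Rmin_left, Rmax_right in Ht by lra.
    unfold dx; rewrite (RInt_Derive (fun y => f y t)).
    + rewrite Hf1, Hf2; apply Rminus_diag.
    + intros x Hx; rewrite Rmin_left, Rmax_right in Hx by lra.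
      apply (Cn_ex_derive_x (box a1 a2 tau) n); auto; split; lra.
    + intros x Hx; rewrite Rmin_left, Rmax_right in Hx by lra.
      apply (Cn_continuous_x a1 a2 tau n (dx f)); try lra; now apply Cn_dx.
Qed.

(** Time is the outer variable. Instead of exchanging the integrals, the inner integral of [dt f] is
    recognised as the time derivative of the inner integral of [f], and the fundamental theorem
    applies outside. Continuity of that derivative takes the second order of smoothness. *)
Lemma RInt2_dt (a1 a2 tau b1 b2 s1 s2 : R) (n : nat) (f : R -> R -> R) :
  inside a1 a2 b1 b2 -> inside 0 tau s1 s2 -> Cn (box a1 a2 tau) (S (S n)) f ->
  (forall x, f x s1 = 0) -> (forall x, f x s2 = 0) ->
  RInt2 b1 b2 s1 s2 (dt f) = 0.
Proof.
  intros Hb (H4 & H5 & H6) Hf Hf1 Hf2; unfold RInt2.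
  apply is_RInt_unique.
  replace 0 with (minus (RInt (fun x => f x s2) b1 b2) (RInt (fun x => f x s1) b1 b2)).
  - apply (is_RInt_derive (fun t => RInt (fun x => f x t) b1 b2));
      intros t Ht; rewrite Rmin_left, Rmax_right in Ht by lra.
    + apply (is_derive_RInt_x a1 a2 tau b1 b2 (S n)); auto; lra.
    + apply (continuous_RInt_x a1 a2 tau b1 b2 n (dt f)); auto; [|lra].
      now apply Cn_dt.
  - rewrite (RInt_ext (fun x => f x s2) (fun x => f x s1)).
    + apply (minus_eq_zero (G := R_AbelianGroup)).
    + intros x _; now rewrite Hf1, Hf2.
Qed.

(** * The first variation of the action *)

Definition wave (rho0 c : R) (w : R -> R -> R) (x t : R) : R :=
  rho0 * dt (dt w) x t - c * dx (dx w) x t.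

(** Symmetric bilinear form of the Lagrangian: on the diagonal it is twice [lagrangian]. The shape
    with [+ - c *] fits the linearity lemmas. *)
Definition polar (rho0 c : R) (w phi : R -> R -> R) (x t : R) : R :=
  rho0 * (dt w x t * dt phi x t) + - c * (dx w x t * dx phi x t).

(** The inequalities are strict so that [phi] also vanishes on the edges of the rectangle, which
    removes the boundary terms of the integrations by parts. *)
Definition supported (b1 b2 s1 s2 : R) (phi : R -> R -> R) : Prop :=
  forall x t, ~ (b1 < x < b2 /\ s1 < t < s2) -> phi x t = 0.

Lemma dx_mult (D : R -> R -> Prop) (n : nat) (f g : R -> R -> R) (x t : R) :
  Cn D (S n) f -> Cn D (S n) g -> D x t ->
  dx (fun x t => f x t * g x t) x t = dx f x t * g x t + f x t * dx g x t.
Proof.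
  intros Hf Hg Hxt.
  apply is_derive_unique, (is_derive_Rmult (fun y => f y t) (fun y => g y t));
    now apply (Cn_ex_derive_x D n).
Qed.

Lemma dt_mult (D : R -> R -> Prop) (n : nat) (f g : R -> R -> R) (x t : R) :
  Cn D (S n) f -> Cn D (S n) g -> D x t ->
  dt (fun x t => f x t * g x t) x t = dt f x t * g x t + f x t * dt g x t.
Proof.
  intros Hf Hg Hxt.
  apply is_derive_unique, (is_derive_Rmult (fun s => f x s) (fun s => g x s));
    now apply (Cn_ex_derive_t D n).
Qed.

Lemma Cn_wave (D : R -> R -> Prop) (n : nat) (rho0 c : R) (w : R -> R -> R) :
  open_2d D -> Cn D (S (S n)) w -> Cn D n (wave rho0 c w).
Proof.
  intros HD Hw.
  apply Cn_ext with (fun x t => rho0 * dt (dt w) x t + - c * dx (dx w) x t); auto.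
  - intros x t _; unfold wave; ring.
  - apply Cn_lin; auto; [apply Cn_dt, Cn_dt | apply Cn_dx, Cn_dx]; auto.
Qed.

Lemma Cn_polar (D : R -> R -> Prop) (n : nat) (rho0 c : R) (w phi : R -> R -> R) :
  open_2d D -> Cn D (S n) w -> Cn D (S n) phi -> Cn D n (polar rho0 c w phi).
Proof.
  intros HD Hw Hphi; apply Cn_lin; auto; apply Cn_mult; auto;
    first [now apply Cn_dt | now apply Cn_dx].
Qed.

(** The sum of [polar] and [wave] times [phi] is the divergence expression rho0 (w_t phi)_t - c (w_x
    phi)_x, whose integral is zero because [phi] vanishes on the edges. *)
Lemma RInt2_polar (a1 a2 tau b1 b2 s1 s2 rho0 c : R) (w phi : R -> R -> R) :
  inside a1 a2 b1 b2 -> inside 0 tau s1 s2 ->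
  Cn (box a1 a2 tau) 3 w -> Cn (box a1 a2 tau) 3 phi ->
  supported b1 b2 s1 s2 phi ->
  RInt2 b1 b2 s1 s2 (polar rho0 c w phi)
  = - RInt2 b1 b2 s1 s2 (fun x t => wave rho0 c w x t * phi x t).
Proof.
  intros Hb Hs Hw Hphi Hsupp; set (D := box a1 a2 tau) in *.
  assert (HD : open_2d D) by apply open_box.
  assert (Hdw : Cn D 2 (dt w) /\ Cn D 2 (dx w)) by (split; [apply Cn_dt | apply Cn_dx]; auto).
  assert (Hphi2 : Cn D 2 phi) by (apply Cn_le with 3%nat; auto).
  set (ft x t := dt w x t * phi x t); set (fx x t := dx w x t * phi x t).
  assert (Hft : Cn D 2 ft) by now apply Cn_mult.
  assert (Hfx : Cn D 2 fx) by now apply Cn_mult.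
  assert (Hwp : Cn D 1 (fun x t => wave rho0 c w x t * phi x t)).
  { apply Cn_mult; auto; [now apply Cn_wave | apply Cn_le with 2%nat; auto]. }
  assert (Hpol : Cn D 1 (polar rho0 c w phi)).
  { apply Cn_polar; auto; apply Cn_le with 3%nat; auto. }
  assert (Hdiv : RInt2 b1 b2 s1 s2 (fun x t => rho0 * dt ft x t + - c * dx fx x t) = 0).
  { rewrite (RInt2_lin a1 a2 tau b1 b2 s1 s2 _ _ 0 (dt ft) (dx fx)); auto;
      try (apply Cn_dt; auto); try (apply Cn_dx; auto).
    rewrite (RInt2_dt a1 a2 tau b1 b2 s1 s2 0 ft), (RInt2_dx a1 a2 tau b1 b2 s1 s2 1 fx);
      auto; try ring; unfold ft, fx; intros; rewrite Hsupp; try ring; lra. }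
  rewrite (RInt2_ext _ _ _ _ _ (fun x t =>
             1 * polar rho0 c w phi x t + 1 * (wave rho0 c w x t * phi x t))) in Hdiv.
  - rewrite (RInt2_lin a1 a2 tau b1 b2 s1 s2 _ _ 0) in Hdiv; auto; lra.
  - apply Hb.
  - apply Hs.
  - intros x t Hx Ht.
    assert (Hxt : D x t) by (unfold inside in Hb, Hs; split; lra).
    unfold ft, fx; rewrite (dt_mult D 1), (dx_mult D 1) by tauto.
    unfold polar, wave; ring.
Qed.

(** * Compactly supported perturbations under improper integrals *)

Lemma supported_dx (b1 b2 s1 s2 : R) (phi : R -> R -> R) (x t : R) :
  supported b1 b2 s1 s2 phi -> ~ (b1 <= x <= b2 /\ s1 <= t <= s2) ->
  dx phi x t = 0.
Proof.
  intros Hsupp Hxt; unfold dx.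
  rewrite (Derive_ext_loc _ (fun _ => 0)); [apply Derive_const |].
  destruct (Rlt_dec x b1) as [H|H].
  { apply (locally_interval _ x m_infty b1); simpl; auto.
    intros y _ Hy; apply Hsupp; lra. }
  destruct (Rlt_dec b2 x) as [H'|H'].
  { apply (locally_interval _ x b2 p_infty); simpl; auto.
    intros y Hy _; apply Hsupp; lra. }
  apply filter_forall; intros y; apply Hsupp; lra.
Qed.

Lemma supported_dt (b1 b2 s1 s2 : R) (phi : R -> R -> R) (x t : R) :
  supported b1 b2 s1 s2 phi -> ~ (b1 <= x <= b2 /\ s1 <= t <= s2) ->
  dt phi x t = 0.
Proof.
  (* Exchanging the two variables turns [dt] into [dx]. *)
  intros Hsupp Hxt; apply (supported_dx s1 s2 b1 b2 (fun t x => phi x t)); try tauto.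
  intros y s Hys; apply Hsupp; tauto.
Qed.

(** Once the endpoints have passed [b1] and [b2], the two outer pieces contribute zero and the
    integral is constantly [l]. *)
Lemma is_RInt_gen_supported (a1 a2 b1 b2 l : R) (f : R -> R) :
  inside a1 a2 b1 b2 -> (forall x, ~ (b1 <= x <= b2) -> f x = 0) ->
  is_RInt f b1 b2 l -> is_RInt_gen f (at_right a1) (at_left a2) l.
Proof.
  intros (H1 & H2 & H3) Hf Hl P HP.
  apply Filter_prod with (fun a => a < b1) (fun b => b2 < b).
  - apply (locally_interval _ a1 m_infty b1); simpl; auto.
  - apply (locally_interval _ a2 b2 p_infty); simpl; auto.
  - intros a b Ha Hb; exists l; split; [|now apply locally_singleton].
    assert (H0 : forall p q, p <= q -> (q <= b1 \/ b2 <= p) -> is_RInt f p q 0).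
    { intros p q Hpq Hout; apply is_RInt_ext with (fun _ => 0).
      - intros x Hx; rewrite Rmin_left, Rmax_right in Hx by lra.
        symmetry; apply Hf; lra.
      - evar_last; [apply (is_RInt_const p q 0) | apply (Rmult_0_r (q - p))]. }
    simpl; evar_last.
    + apply (is_RInt_Chasles f a b2 b (0 + l) 0); [|apply H0; lra].
      apply (is_RInt_Chasles f a b1 b2 0 l); auto; apply H0; lra.
    + unfold plus; simpl; ring.
Qed.

(** Brings a pointwise statement on the open interval into the form that [is_RInt_gen_ext] demands
    of two integrands. *)
Lemma filter_prod_inside (a1 a2 : R) (P : R -> Prop) :
  a1 < a2 -> (forall x, a1 < x < a2 -> P x) ->
  filter_prod (at_right a1) (at_left a2)
    (fun ab => forall x, Rmin (fst ab) (snd ab) < x < Rmax (fst ab) (snd ab) -> P x).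
Proof.
  intros Ha HP.
  apply Filter_prod with (fun a => a1 < a < a2) (fun b => a1 < b < a2).
  - apply (locally_interval _ a1 m_infty a2); simpl; auto.
  - apply (locally_interval _ a2 a1 p_infty); simpl; auto.
  - intros a b Ha' Hb' x Hx; apply HP; simpl in Hx.
    unfold Rmin, Rmax in Hx; destruct (Rle_dec a b); lra.
Qed.

(* The perturbed Lagrangian differs from the unperturbed one by a function
   supported in a compact rectangle, so the improper integrals only enter
   through the action of [w]. *)
Lemma action_perturbed (a1 a2 tau b1 b2 s1 s2 rho0 c : R) (w phi : R -> R -> R) (eps : R) :
  inside a1 a2 b1 b2 -> inside 0 tau s1 s2 ->
  Cn (box a1 a2 tau) 2 w -> Cn (box a1 a2 tau) 2 phi ->
  supported b1 b2 s1 s2 phi -> action_defined a1 a2 tau rho0 c w ->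
  action a1 a2 tau rho0 c (fun x t => w x t + eps * phi x t)
  = action a1 a2 tau rho0 c w
    + (eps * RInt2 b1 b2 s1 s2 (polar rho0 c w phi)
       + eps ^ 2 / 2 * RInt2 b1 b2 s1 s2 (polar rho0 c phi phi)).
Proof.
  intros Hb Hs Hw Hphi Hsupp [Hdef1 Hdef2].
  assert (Ha : a1 < a2) by (unfold inside in Hb; lra).
  assert (Ht : 0 < tau) by (unfold inside in Hs; lra).
  assert (Hpw : Cn (box a1 a2 tau) 1 (polar rho0 c w phi)) by now apply Cn_polar.
  assert (Hpp : Cn (box a1 a2 tau) 1 (polar rho0 c phi phi)) by now apply Cn_polar.
  rewrite <- (RInt2_lin a1 a2 tau b1 b2 s1 s2 _ _ 0) by auto.
  (* [K] is the exact increment of the Lagrangian. The factor 1/2 appears because [polar] of [phi]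
     with itself is twice the Lagrangian of [phi]. *)
  set (K x t := eps * polar rho0 c w phi x t + eps ^ 2 / 2 * polar rho0 c phi phi x t).
  assert (HK : Cn (box a1 a2 tau) 1 K) by now apply Cn_lin.
  assert (HK0 : forall x t, ~ (b1 <= x <= b2 /\ s1 <= t <= s2) -> K x t = 0).
  { intros x t Hxt; unfold K, polar.
    rewrite (supported_dx b1 b2 s1 s2 phi x t), (supported_dt b1 b2 s1 s2 phi x t) by auto.
    field. }
  assert (HL : forall x t, a1 < x < a2 -> 0 < t < tau ->
    lagrangian rho0 c (fun x t => w x t + eps * phi x t) x t
    = lagrangian rho0 c w x t + K x t).
  { intros x t Hx Ht'.
    assert (Hxt : box a1 a2 tau x t) by (split; auto).
    assert (Hdx : dx (fun x t => w x t + eps * phi x t) x t = dx w x t + eps * dx phi x t).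
    { unfold dx; rewrite Derive_plus, Derive_scal; auto.
      - now apply (Cn_ex_derive_x (box a1 a2 tau) 1).
      - apply ex_derive_scal; now apply (Cn_ex_derive_x (box a1 a2 tau) 1). }
    assert (Hdt : dt (fun x t => w x t + eps * phi x t) x t = dt w x t + eps * dt phi x t).
    { unfold dt; rewrite Derive_plus, Derive_scal; auto.
      - now apply (Cn_ex_derive_t (box a1 a2 tau) 1).
      - apply ex_derive_scal; now apply (Cn_ex_derive_t (box a1 a2 tau) 1). }
    unfold lagrangian; rewrite Hdx, Hdt; unfold K, polar; field. }
  apply is_RInt_gen_unique.
  apply is_RInt_gen_ext with (fun t =>
    plus (RInt_gen (fun x => lagrangian rho0 c w x t) (at_right a1) (at_left a2))
         (RInt (fun x => K x t) b1 b2)).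
  - apply filter_prod_inside; auto; intros t Ht'.
    symmetry; apply is_RInt_gen_unique.
    apply is_RInt_gen_ext with (fun x => plus (lagrangian rho0 c w x t) (K x t)).
    + apply filter_prod_inside; auto; intros x Hx; symmetry; now apply HL.
    + apply (is_RInt_gen_plus (fun x => lagrangian rho0 c w x t)).
      * now apply (RInt_gen_correct (V := R_CompleteNormedModule)), Hdef1.
      * apply is_RInt_gen_supported with b1 b2; auto.
        -- intros x Hx; apply HK0; tauto.
        -- apply (RInt_correct (fun x => K x t)).
           now apply (Cn_ex_RInt_x a1 a2 tau b1 b2 1).
  - apply (is_RInt_gen_plus
      (fun t => RInt_gen (fun x => lagrangian rho0 c w x t) (at_right a1) (at_left a2))).
    + now apply (RInt_gen_correct (V := R_CompleteNormedModule)).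
    + apply is_RInt_gen_supported with s1 s2; auto.
      * intros t Ht'; rewrite (RInt_ext _ (fun _ => 0)).
        -- rewrite RInt_const; apply (Rmult_0_r (b2 - b1)).
        -- intros x _; apply HK0; tauto.
      * apply (RInt_correct (fun t => RInt (fun x => K x t) b1 b2)).
        now apply (ex_RInt2 a1 a2 tau b1 b2 s1 s2 0).
Qed.

Lemma is_derive_action (a1 a2 tau b1 b2 s1 s2 rho0 c : R) (w phi : R -> R -> R) :
  inside a1 a2 b1 b2 -> inside 0 tau s1 s2 ->
  Cn (box a1 a2 tau) 3 w -> Cn (box a1 a2 tau) 3 phi ->
  supported b1 b2 s1 s2 phi -> action_defined a1 a2 tau rho0 c w ->
  is_derive
    (fun eps => action a1 a2 tau rho0 c (fun x t => w x t + eps * phi x t)) 0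
    (- RInt2 b1 b2 s1 s2 (fun x t => wave rho0 c w x t * phi x t)).
Proof.
  intros Hb Hs Hw Hphi Hsupp Hdef.
  rewrite <- (RInt2_polar a1 a2 tau b1 b2 s1 s2) by auto.
  eapply is_derive_ext.
  - intros eps; symmetry; apply (action_perturbed a1 a2 tau b1 b2 s1 s2); auto;
      apply Cn_le with 3%nat; auto.
  - auto_derive; auto; field.
Qed.

(** * Stationarity and the wave equation *)

Lemma test_field_supported (a1 a2 tau : R) (phi : R -> R -> R) :
  test_field a1 a2 tau phi ->
  exists b1 b2 s1 s2, inside a1 a2 b1 b2 /\ inside 0 tau s1 s2 /\
    supported b1 b2 s1 s2 phi.
Proof.
  intros (_ & b1 & b2 & s1 & s2 & Hb & Hs & H0).
  (* Moving each side halfway to the boundary makes the rectangle nondegenerate and puts its edges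
     outside the support of [phi]. *)
  exists ((a1 + b1) / 2), ((b2 + a2) / 2), (s1 / 2), ((s2 + tau) / 2).
  split; [unfold inside; lra |]; split; [unfold inside; lra |].
  intros x t Hxt; apply H0; lra.
Qed.

Lemma smooth_on_Cn (D E : R -> R -> Prop) (n : nat) (w : R -> R -> R) :
  (forall x t, E x t -> D x t) -> smooth_on D w -> Cn E n w.
Proof.
  intros HED Hw x t Hxt.
  exact (locally_2d_singleton _ _ _ (Hw x t (HED x t Hxt)) n).
Qed.

Lemma wave_stationary (a1 a2 tau rho0 c : R) (w : R -> R -> R) :
  Cn (box a1 a2 tau) 3 w -> action_defined a1 a2 tau rho0 c w ->
  (forall x t, box a1 a2 tau x t -> wave rho0 c w x t = 0) ->
  stationary a1 a2 tau rho0 c w.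
Proof.
  intros Hw Hdef Hwave phi Hphi.
  destruct (test_field_supported _ _ _ _ Hphi) as (b1 & b2 & s1 & s2 & Hb & Hs & Hsupp).
  replace 0 with (- RInt2 b1 b2 s1 s2 (fun x t => wave rho0 c w x t * phi x t)) at 2.
  - apply is_derive_action; auto.
    apply (smooth_on_Cn (fun _ _ => True)); auto; apply Hphi.
  (* Zero is written as a linear combination so that [RInt2_lin] evaluates the integral. *)
  - rewrite (RInt2_ext _ _ _ _ _ (fun _ _ => 0 * 0 + 0 * 0)).
    + rewrite (RInt2_lin a1 a2 tau b1 b2 s1 s2 0 0 0 (fun _ _ => 0) (fun _ _ => 0));
        auto; try (now apply Cn_const); ring.
    + apply Hb.
    + apply Hs.
    + intros x t Hx Ht; rewrite Hwave; [ring |].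
      unfold inside in Hb, Hs; split; lra.
Qed.

Lemma continuity_2d_pt_pos (g : R -> R -> R) (x t : R) :
  continuity_2d_pt g x t -> 0 < g x t -> locally_2d (fun y s => 0 < g y s) x t.
Proof.
  intros Hg H0; destruct (Hg (mkposreal _ H0)) as [d Hd]; exists d.
  intros y s Hy Hs; specialize (Hd y s Hy Hs); simpl in Hd.
  apply Rabs_def2 in Hd; lra.
Qed.

(** Fundamental lemma of the calculus of variations: if [wave] were nonzero at a point, a bump
    concentrated near it would give a nonzero first variation. *)
Lemma stationary_wave (a1 a2 tau rho0 c : R) (w : R -> R -> R) (x t : R) :
  Cn (box a1 a2 tau) 3 w -> action_defined a1 a2 tau rho0 c w ->
  stationary a1 a2 tau rho0 c w -> box a1 a2 tau x t -> wave rho0 c w x t = 0.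
Proof.
  intros Hw Hdef Hst Hxt.
  destruct (Req_dec (wave rho0 c w x t) 0) as [|Hne]; auto; exfalso.
  (* Multiplication by the value [m] makes the function positive at the point, its value there being
     a square, and so treats both signs at once. *)
  set (m := wave rho0 c w x t).
  assert (Hm : 0 < m * wave rho0 c w x t) by (destruct (Rdichotomy _ _ Hne); unfold m; nra).
  assert (HG : Cn (box a1 a2 tau) 1 (fun x t => m * wave rho0 c w x t)).
  { apply Cn_mult; auto; [now apply Cn_const | now apply Cn_wave]. }
  destruct (locally_2d_and _ _ _ _ (open_box a1 a2 tau x t Hxt)
    (continuity_2d_pt_pos _ _ _ (Cn_continuity_2d _ _ _ _ _ HG Hxt) Hm)) as [d Hd].
  assert (Hd0 := cond_pos d).
  (* Half the radius [d] keeps the closed rectangle in the neighbourhood where [box] holds and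
     [m * wave] is positive. *)
  set (b1 := x - d / 2); set (b2 := x + d / 2).
  set (s1 := t - d / 2); set (s2 := t + d / 2).
  assert (Hin : forall y s, b1 <= y <= b2 -> s1 <= s <= s2 ->
    box a1 a2 tau y s /\ 0 < m * wave rho0 c w y s).
  { unfold b1, b2, s1, s2; intros y s Hy Hs; apply Hd; apply Rabs_def1; lra. }
  assert (Hb : inside a1 a2 b1 b2 /\ inside 0 tau s1 s2).
  { assert (H12 : b1 <= b2 /\ s1 <= s2) by (unfold b1, b2, s1, s2; lra).
    destruct (Hin b1 s1) as [[H1 H2] _]; try lra.
    destruct (Hin b2 s2) as [[H3 H4] _]; try lra.
    unfold inside; unfold b1, b2, s1, s2 in *; lra. }
  destruct Hb as [Hb Hs].
  set (phi := bump b1 b2 s1 s2).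
  assert (HF : Cn (box a1 a2 tau) 1 (fun x t => wave rho0 c w x t * phi x t)).
  { apply Cn_mult; auto; [now apply Cn_wave | now apply Cn_bump]. }
  assert (Hsupp : supported b1 b2 s1 s2 phi) by (intros y s; apply bump_0).
  assert (Htest : test_field a1 a2 tau phi).
  { split.
    - intros y s _; apply locally_2d_forall; intros u v n.
      apply (Cn_bump (fun _ _ => True)); auto.
      intros p q _; now apply locally_2d_forall.
    - unfold inside in Hb, Hs; exists b1, b2, s1, s2.
      split; [lra |]; split; [lra |]; intros y s Hys; apply Hsupp; lra. }
  assert (Hder := is_derive_action a1 a2 tau b1 b2 s1 s2 rho0 c w phi
    Hb Hs Hw (Cn_bump _ 3 b1 b2 s1 s2 (open_box a1 a2 tau)) Hsupp Hdef).
  (* The derivative of the action at 0 has two expressions; by uniqueness the integral of [wave]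
     times [phi] is zero. *)
  assert (H0 := eq_trans (eq_sym (is_derive_unique _ _ _ Hder))
                         (is_derive_unique _ _ _ (Hst phi Htest))).
  (* The integrand is [m * wave] times the bump, positive inside the rectangle; the null second term
     only fits the shape of [RInt2_lin]. *)
  assert (Hpos : 0 < RInt2 b1 b2 s1 s2 (fun x t =>
    m * (wave rho0 c w x t * phi x t) + 0 * (wave rho0 c w x t * phi x t))).
  { assert (HmF : Cn (box a1 a2 tau) 1 (fun x t =>
      m * (wave rho0 c w x t * phi x t) + 0 * (wave rho0 c w x t * phi x t)))
      by now apply Cn_lin.
    unfold inside in Hs; apply RInt_gt_0; [lra | | intros s Hs'].
    - intros s Hs'; unfold inside in Hb; apply RInt_gt_0; [lra | | intros y Hy].
      + intros y Hy; rewrite Rmult_0_l, Rplus_0_r, <- Rmult_assoc.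
        apply Rmult_lt_0_compat; [apply Hin; lra | now apply bump_pos].
      + apply (Cn_continuous_x a1 a2 tau 1 _ _ _ HmF); lra.
    - apply (continuous_RInt_x a1 a2 tau b1 b2 0 _ _ Hb HmF); lra. }
  rewrite (RInt2_lin a1 a2 tau b1 b2 s1 s2 _ _ 0) in Hpos by auto.
  nra.
Qed.

(** * The energy of a solution of the wave equation *)

Lemma dx_dt_comm (D : R -> R -> Prop) (w : R -> R -> R) (x t : R) :
  open_2d D -> Cn D 2 w -> D x t -> dx (dt w) x t = dt (dx w) x t.
Proof.
  intros HD Hw Hxt; apply (Schwarz w x t).
  - revert x t Hxt; apply open_2d_locally; auto; intros x t Hxt.
    split; [apply (Cn_ex_derive_x D 1 w); auto |].
    split; [apply (Cn_ex_derive_t D 1 w); auto |].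
    split; [apply (Cn_ex_derive_x D 0 (dt w)); auto; now apply Cn_dt |].
    apply (Cn_ex_derive_t D 0 (dx w)); auto; now apply Cn_dx.
  - apply (Cn_continuity_2d D 0 (dx (dt w))); auto; now apply Cn_dx, Cn_dt.
  - apply (Cn_continuity_2d D 0 (dt (dx w))); auto; now apply Cn_dt, Cn_dx.
Qed.

Lemma Cn_energy (D : R -> R -> Prop) (n : nat) (rho0 c : R) (w : R -> R -> R) :
  open_2d D -> Cn D (S n) w -> Cn D n (energy rho0 c w).
Proof.
  intros HD Hw.
  apply Cn_ext with (fun x t =>
    rho0 / 2 * (dt w x t * dt w x t) + c / 2 * (dx w x t * dx w x t)); auto.
  - intros x t _; unfold energy; ring.
  - apply Cn_lin; auto; apply Cn_mult; auto; first [now apply Cn_dt | now apply Cn_dx].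
Qed.

Lemma dx_ext_open (D : R -> R -> Prop) (f g : R -> R -> R) (x t : R) :
  open_2d D -> (forall x t, D x t -> f x t = g x t) -> D x t -> dx f x t = dx g x t.
Proof.
  intros HD Hfg Hxt; apply Derive_ext_loc.
  apply (locally_2d_1d_const_y (fun y s => f y s = g y s)).
  revert x t Hxt; now apply open_2d_locally.
Qed.

Lemma dt_ext_open (D : R -> R -> Prop) (f g : R -> R -> R) (x t : R) :
  open_2d D -> (forall x t, D x t -> f x t = g x t) -> D x t -> dt f x t = dt g x t.
Proof.
  intros HD Hfg Hxt; apply Derive_ext_loc.
  apply (locally_2d_1d_const_x (fun y s => f y s = g y s)).
  revert x t Hxt; now apply open_2d_locally.
Qed.

Lemma dx_energy (D : R -> R -> Prop) (n : nat) (rho0 c : R) (w : R -> R -> R) (x t : R) :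
  Cn D (S (S n)) w -> D x t ->
  dx (energy rho0 c w) x t
  = rho0 * (dt w x t * dx (dt w) x t) + c * (dx w x t * dx (dx w) x t).
Proof.
  intros Hw Hxt; apply is_derive_unique.
  assert (H1 : ex_derive (fun y => dt w y t) x)
    by (apply (Cn_ex_derive_x D n (dt w)); auto; now apply Cn_dt).
  assert (H2 : ex_derive (fun y => dx w y t) x)
    by (apply (Cn_ex_derive_x D n (dx w)); auto; now apply Cn_dx).
  unfold energy; auto_derive; [tauto |].
  change (Derive (fun y => dt w y t) x) with (dx (dt w) x t).
  change (Derive (fun y => dx w y t) x) with (dx (dx w) x t).
  field.
Qed.

Lemma dt_energy (D : R -> R -> Prop) (n : nat) (rho0 c : R) (w : R -> R -> R) (x t : R) :
  Cn D (S (S n)) w -> D x t ->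
  dt (energy rho0 c w) x t
  = rho0 * (dt w x t * dt (dt w) x t) + c * (dx w x t * dt (dx w) x t).
Proof.
  intros Hw Hxt; apply is_derive_unique.
  assert (H1 : ex_derive (fun y => dt w x y) t)
    by (apply (Cn_ex_derive_t D n (dt w)); auto; now apply Cn_dt).
  assert (H2 : ex_derive (fun y => dx w x y) t)
    by (apply (Cn_ex_derive_t D n (dx w)); auto; now apply Cn_dx).
  unfold energy; auto_derive; [tauto |].
  change (Derive (fun s => dt w x s) t) with (dt (dt w) x t).
  change (Derive (fun s => dx w x s) t) with (dt (dx w) x t).
  field.
Qed.

(** [HEt] and [HEx] below are the balance laws of energy and of momentum for the wave equation. *)
Lemma wave_energy (D : R -> R -> Prop) (rho0 c : R) (w : R -> R -> R) (x t : R) :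
  open_2d D -> Cn D 3 w -> (forall x t, D x t -> wave rho0 c w x t = 0) ->
  D x t -> wave rho0 c (energy rho0 c w) x t = 0.
Proof.
  intros HD Hw Hwave Hxt.
  assert (Hdt : Cn D 2 (dt w)) by now apply Cn_dt.
  assert (Hdx : Cn D 2 (dx w)) by now apply Cn_dx.
  (* Up to constant factors, [P] is both the energy flux and the momentum density. *)
  set (P x t := dt w x t * dx w x t).
  assert (HP : Cn D 2 P) by now apply Cn_mult.
  assert (Hcomm : forall x t, D x t -> dx (dt w) x t = dt (dx w) x t).
  { intros y s Hys; apply (dx_dt_comm D); auto; apply Cn_le with 3%nat; auto. }
  assert (Hwave' : forall x t, D x t -> rho0 * dt (dt w) x t = c * dx (dx w) x t).
  { intros y s Hys; apply Rminus_diag_uniq; now apply Hwave. }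
  assert (HEt : forall x t, D x t -> dt (energy rho0 c w) x t = c * dx P x t).
  { intros y s Hys; unfold P; rewrite (dt_energy D 1), (dx_mult D 1), Hcomm by auto.
    rewrite <- Rmult_assoc, (Rmult_comm rho0), Rmult_assoc, Hwave' by auto; ring. }
  assert (HEx : forall x t, D x t -> dx (energy rho0 c w) x t = rho0 * dt P x t).
  { intros y s Hys; unfold P; rewrite (dx_energy D 1), (dt_mult D 1), Hcomm by auto.
    replace (c * (dx w y s * dx (dx w) y s))
      with (dx w y s * (c * dx (dx w) y s)) by ring.
    rewrite <- Hwave' by auto; ring. }
  unfold wave.
  rewrite (dt_ext_open D _ _ x t HD HEt Hxt), (dx_ext_open D _ _ x t HD HEx Hxt).
  (* Only the outer derivatives are unfolded, to extract the constants; what remains is [rho0 * c]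
     times the difference of the two mixed derivatives of [P]. *)
  unfold dt at 1, dx at 2; rewrite !Derive_scal.
  change (rho0 * (c * dt (dx P) x t) - c * (rho0 * dx (dt P) x t) = 0).
  rewrite (dx_dt_comm D) by auto; ring.
Qed.

Theorem theorem3 :
  forall (a1 a2 tau rho0 c : R) (u : R -> R -> R),
    a1 < a2 -> 0 < tau -> 0 < rho0 -> 0 < c ->
    smooth_on (fun x t => a1 < x < a2 /\ 0 <= t <= tau) u ->
    action_defined a1 a2 tau rho0 c u ->
    stationary a1 a2 tau rho0 c u ->
    forall i : nat,
      action_defined a1 a2 tau rho0 c (field_seq rho0 c u i) ->
      stationary a1 a2 tau rho0 c (field_seq rho0 c u i).
Proof.
  intros a1 a2 tau rho0 c u _ _ _ _ Hu Hdef Hst i Hdefi.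
  assert (Hi : (forall n, Cn (box a1 a2 tau) n (field_seq rho0 c u i)) /\
    forall x t, box a1 a2 tau x t -> wave rho0 c (field_seq rho0 c u i) x t = 0).
  (* The invariant carries every order of smoothness, since each energy costs one derivative.
     Convergence of the action enters at the two ends: at level [0] to pass from stationarity to the
     wave equation, and at level [i] to return. *)
  { clear Hdefi; induction i as [|i [IHs IHw]]; simpl.
    - assert (Hs : forall n, Cn (box a1 a2 tau) n u).
      { intros n; apply (smooth_on_Cn (fun x t => a1 < x < a2 /\ 0 <= t <= tau)); auto.
        unfold box; intros x t Hxt; lra. }
      split; auto; intros x t Hxt; now apply (stationary_wave a1 a2 tau).
    - split.
      + intros n; now apply Cn_energy.
      + intros x t Hxt; now apply (wave_energy (box a1 a2 tau)). }
  now apply wave_stationary.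
Qed.
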